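(* For all integers $n\geq k\geq 1$, $$H_1(n,k)=4^{k-1}(n-k)+\frac13\left(4^{k-1}-1\right).$$
   Context: For positive integers $r,n,k$, let $H_r(n,k)$ be the number of $n\times k$ arrays of integers (rows indexed $i=1,\dots,n$, columns indexed $j=1,\dots,k$) which obey the following rules: (1) the entry in position $(1,1)$ is $0$, and the entry in position $(n,k)$ is $\max(n,k)-r-1$; (2) the entry in position $(i,j)$ must equal or be one more than each of the entries in positions $(i-1,j)$, $(i,j-1)$, and $(i-1,j-1)$ (whenever those positions exist in the array); (3) the entry in position $(i,j)$ must be within $r$ of $\max(i,j)-1$, i.e. differ from it by at most $r$ in absolute value. (If the rules are contradictory, as for $n=k=1$, the count is $0$.) *)

(* Defs.v *)
From mathcomp Require Import all_boot all_order all_algebra finmap.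
From mathcomp Require Import zify.
From mathcomp Require Import mathcomp_extra boolp classical_sets functions cardinality.

Set Implicit Arguments.
Unset Strict Implicit.
Unset Printing Implicit Defensive.

Import Order.TTheory GRing.Theory Num.Theory.

Local Open Scope classical_set_scope.
Local Open Scope ring_scope.

(* Ordinals count from 0: the entry [A i j] sits in position (i + 1, j + 1). *)

(* [(i', j')] is [(i - 1, j)], [(i, j - 1)] or [(i - 1, j - 1)]. *)
Definition precedes (i' j' i j : nat) : Prop :=
  [\/ i'.+1 = i /\ j' = j,
      i' = i /\ j'.+1 = j
    | i'.+1 = i /\ j'.+1 = j].

Definition rule1 (r n k : nat) (A : 'M[int]_(n, k)) : Prop :=
  (forall (i : 'I_n) (j : 'I_k), i.+1 = 1%N -> j.+1 = 1%N -> A i j = 0) /\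
  (forall (i : 'I_n) (j : 'I_k), i.+1 = n -> j.+1 = k ->
     A i j = (maxn n k)%:Z - r%:Z - 1).

Definition rule2 (n k : nat) (A : 'M[int]_(n, k)) : Prop :=
  forall (i i' : 'I_n) (j j' : 'I_k), precedes i' j' i j ->
    A i j = A i' j' \/ A i j = A i' j' + 1.

Definition rule3 (r n k : nat) (A : 'M[int]_(n, k)) : Prop :=
  forall (i : 'I_n) (j : 'I_k),
    `|A i j - ((maxn i.+1 j.+1)%:Z - 1)| <= r%:Z.

Definition arrays (r n k : nat) : set 'M[int]_(n, k) :=
  [set A | [/\ rule1 r A, rule2 A & rule3 r A]].
Arguments arrays : clear implicits.

Lemma finite_arrays (r n k : nat) : finite_set (arrays r n k).
Proof.
pose f (B : 'M['I_(r + r).+1]_(n, k)) : 'M[int]_(n, k) :=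
  \matrix_(i, j) ((B i j : nat)%:Z + (maxn i.+1 j.+1)%:Z - 1 - r%:Z).
apply: (@sub_finite_set _ _ (f @` setT)); last first.
  by apply: finite_image; exact: finite_finset.
move=> A [_ _ A3].
exists (\matrix_(i, j)
  inord (absz (A i j - ((maxn i.+1 j.+1)%:Z - 1) + r%:Z))) => //.
apply/matrixP => i j; rewrite !mxE; have := A3 i j => Aij.
by rewrite inordK; lia.
Qed.

(* [fset_set] sends an infinite set to [fset0]; by [finite_arrays] this default
   value is never used here. *)
Definition H (r n k : nat) : nat := #|` fset_set (arrays r n k)|.

(* Main.v *)
(** Subtracting the array from [max(i, j) - 1] leaves a 0/1 array [b], in which
    the cells on or below the diagonal and the cells on or above it interact
    only through the diagonal itself. Below the diagonal, the first row
    carrying a 1 in column [j] goes up by 0 or 1 as [j] increases, so this half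
    is determined by its value [t] in the column preceding the first 1 on the
    diagonal, together with the set [S] of columns where it goes up. With
    [m = min(t, k)] the set [S] is an arbitrary subset of [{1, ..., m - 1}], and
    the upper half is given in the same way by [m] and another such subset.
    Hence [H_1(n, k)] is the sum of [4^(min(t, k) - 1)] over [0 < t < n]. *)

Require Import Defs.
From mathcomp Require Import classical_sets cardinality finmap.
From mathcomp Require Import all_boot all_order all_algebra.
From mathcomp Require Import zify ring.

Set Implicit Arguments.
Unset Strict Implicit.
Unset Printing Implicit Defensive.

Import Order.TTheory GRing.Theory Num.Theory.
Local Open Scope ring_scope.

(** * Staircases: 0/1 arrays on one side of the diagonal *)

Section Staircase.
Context {k : nat}.
Implicit Types (S : {set 'I_k}) (t i j m N : nat).
Local Open Scope nat_scope.

Definition count_above S j : nat := #|[set s in S | j < s]|.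

(* The entries [i >= j] of a 0/1 array: column [j] starts carrying ones in row
   [t - count_above S j]. *)
Definition stair t S i j : bool := t <= i + count_above S j.

(** Column [s] records a step up from [s - 1], so [0] is left out; from column [m] on, the ones
    start at the diagonal. *)
Definition rises m : {set 'I_k} := [set s : 'I_k | 0 < s < m].

(** Below the diagonal [max(i, j)] grows with [i] and is constant in [j], so the three neighbour
    conditions become these closures of the deficit. The upper half is treated by transposition. *)
Definition staircase N (b : nat -> nat -> bool) : Prop :=
  [/\ forall i j, j <= i -> i.+1 < N -> j < k -> b i j -> b i.+1 j,
      forall i j, j < i -> i < N -> j.+1 < k -> b i j.+1 -> b i j
    & forall i j, j <= i -> i.+1 < N -> j.+1 < k -> b i j -> b i.+1 j.+1].

Lemma count_above_step S (s : 'I_k) j :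
  s = j.+1 :> nat -> count_above S j = (s \in S) + count_above S j.+1.
Proof.
move=> sj; rewrite /count_above (cardsD1 s) !inE; congr (_ + _).
  by rewrite sj ltnSn andbT.
apply: eq_card => u; rewrite !inE -val_eqE /= sj.
by case: (u \in S); rewrite ?andbF //=; lia.
Qed.

Lemma count_above_ge S j : k <= j.+1 -> count_above S j = 0.
Proof.
move=> kj; apply: eq_card0 => u; rewrite !inE.
by have := ltn_ord u; case: (u \in S) => //=; lia.
Qed.

Lemma count_above_succ S j :
  count_above S j.+1 <= count_above S j <= (count_above S j.+1).+1.
Proof.
case: (ltnP j.+1 k) => jk; last by rewrite !count_above_ge //; lia.
by rewrite (@count_above_step S (Ordinal jk) j) //; case: (_ \in S); lia.
Qed.

Lemma count_above_bound S m j :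
  S \subset rises m -> count_above S j <= m - j.+1.
Proof.
move=> /subsetP Sm.
have [d] : exists d, d = m - j.+1 by eexists.
elim: d j => [|d IH] j dE.
  rewrite [count_above S j]eq_card0 // => u; rewrite !inE.
  by apply/negP => /andP[/Sm]; rewrite inE; lia.
by have := IH j.+1; have := count_above_succ S j; lia.
Qed.

(** For [j < m] the bound gives [j + count_above S j < m <= t]; for [m <= j < k] the count is 0 and
    [t = m]. *)
Lemma stair_diag m t S j :
  S \subset rises m -> minn t k = m -> j < k -> stair t S j j = (m <= j).
Proof. by move=> Sm; rewrite /stair; have := count_above_bound j Sm; lia. Qed.

Lemma stair_staircase N t S : staircase N (stair t S).
Proof.
by split=> i j; have := count_above_succ S j; rewrite /stair; lia.
Qed.

(** A column [s > 0] lies in [S] exactly when the count drops from [s - 1] to [s]. *)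
Lemma count_above_inj m S1 S2 :
  S1 \subset rises m -> S2 \subset rises m ->
  (forall j, j < m -> count_above S1 j = count_above S2 j) -> S1 = S2.
Proof.
move=> S1m S2m eqc.
have le0 S j : S \subset rises m -> m <= j -> count_above S j = 0.
  by move=> Sm mj; have := count_above_bound j Sm; lia.
have eqc' j : count_above S1 j = count_above S2 j.
  by case: (ltnP j m) => jm; [exact: eqc | rewrite !le0].
apply/setP => s; case: (posnP s) => [s0|s_gt0].
  have notin S : S \subset rises m -> s \in S = false.
    by move=> /subsetP Sm; apply/negP => /Sm; rewrite inE s0.
  by rewrite !notin.
have sE : s = s.-1.+1 :> nat by rewrite prednK.
have := eqc' s.-1; rewrite !(@count_above_step _ s s.-1) // eqc'.
by case: (s \in S1); case: (s \in S2) => //=; lia.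
Qed.

(** Column [m - 1] has count 0, so its ones start in row [t], where [t = N] means that it has none.
    The start of column [j] then gives [count_above S j], hence [S]. *)
Lemma stair_inj N m t1 t2 S1 S2 :
  0 < m -> k <= N -> t1 <= N -> t2 <= N ->
  S1 \subset rises m -> S2 \subset rises m ->
  minn t1 k = m -> minn t2 k = m ->
  (forall i j, j <= i -> i < N -> j < k -> stair t1 S1 i j = stair t2 S2 i j) ->
  t1 = t2 /\ S1 = S2.
Proof.
move=> m_gt0 kN t1N t2N S1m S2m t1m t2m eqs.
have bnd S j : S \subset rises m -> count_above S j <= m - j.+1.
  exact: count_above_bound.
have t12 : t1 = t2.
  have := bnd S1 m.-1 S1m; have := bnd S2 m.-1 S2m.
  have := eqs t1 m.-1; have := eqs t2 m.-1; rewrite /stair.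
  by case: (ltngtP t1 t2); lia.
split=> //; apply: (count_above_inj S1m S2m) => j jm.
have := bnd S1 j S1m; have := bnd S2 j S2m.
have := eqs (t1 - count_above S1 j) j; have := eqs (t1 - count_above S2 j) j.
rewrite /stair -t12.
by case: (ltngtP (count_above S1 j) (count_above S2 j)); lia.
Qed.

(** Telescoping: each rise adds exactly 1, so the rises after column [j] number
    [h (m - 1) - h j]. *)
Lemma count_above_heights (h : nat -> nat) m j :
    (forall j, j.+1 < m -> h j <= h j.+1 <= (h j).+1) ->
    j < m -> m <= k ->
  h j + count_above [set s : 'I_k | (0 < s < m) && (h s.-1 < h s)] j = h m.-1.
Proof.
set S := [set s | _] => hstep jm mk.
have Sm : S \subset rises m by apply/subsetP => s; rewrite !inE => /andP[].
have [d] : exists d, d = m.-1 - j by eexists.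
elim: d j jm => [|d IH] j jm dE.
  have -> : j = m.-1 by lia.
  by have := count_above_bound m.-1 Sm; lia.
have j1k : j.+1 < k by lia.
rewrite (@count_above_step S (Ordinal j1k) j) // inE /=.
have := hstep j; have := IH j.+1.
by case: ltnP; lia.
Qed.

(** Take for [t] the start of column [m - 1], and for [S] the columns before [m] whose start exceeds
    the previous one. *)
Lemma stair_surj (b : nat -> nat -> bool) N m :
    0 < m <= k -> k <= N ->
    staircase N b ->
    (forall j, j < k -> b j j = (m <= j)) ->
  exists t S, [/\ S \subset rises m, minn t k = m, t <= N &
    forall i j, j <= i -> i < N -> j < k -> b i j = stair t S i j].
Proof.
move=> /andP[m_gt0 mk] kN [bdown bleft bslant] bdiag.
(* The first row on or below the diagonal with a 1 in column [j]; [find] gives [N] if there is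
   none. *)
pose h j := find (fun i => (j <= i) && b i j) (iota 0 N).
have hN j : h j <= N by rewrite -[leqRHS](size_iota 0) find_size.
have hP j : h j < N -> (j <= h j) && b (h j) j.
  move=> hj; have := @nth_find _ 0 (fun i => (j <= i) && b i j) (iota 0 N).
  by rewrite has_find size_iota nth_iota // => /(_ hj).
have hmin i j : i < N -> j <= i -> b i j -> h j <= i.
  move=> iN ji bij; rewrite leqNgt; apply/negP => ih.
  by have := before_find 0 ih; rewrite nth_iota // add0n ji bij.
have mono j i d : j <= i -> i + d < N -> j < k -> b i j -> b (i + d) j.
  move=> ji + jk bij; elim: d => [|d IH]; first by rewrite addn0.
  by rewrite addnS => idN; apply: bdown; [lia | lia | lia | apply: IH; lia].
have hE i j : j <= i -> i < N -> j < k -> b i j = (h j <= i).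
  move=> ji iN jk; apply/idP/idP; first exact: hmin.
  move=> hi; have /andP[jh bh] := hP j (leq_ltn_trans hi iN).
  by rewrite -(subnKC hi); apply: mono => //; lia.
have hstep j : j.+1 < k -> h j <= h j.+1 <= (h j).+1.
  move=> jk; apply/andP; split.
    case: (ltnP (h j.+1) N) => [lt|]; last by have := hN j; lia.
    have /andP[jh bh] := hP _ lt.
    by apply: hmin => //; [lia | apply: bleft].
  case: (ltnP (h j).+1 N) => [lt|]; last by have := hN j.+1; lia.
  have /andP[jh bh] := hP j (ltnW lt).
  by apply: hmin => //; apply: bslant.
have m1k : m.-1 < k by lia.
have ht : m <= h m.-1.
  have [//|hm] := leqP m (h m.-1).
  have := hE m.-1 m.-1; have := bdiag _ m1k; lia.
(* The cell [(m, m)] carries a 1, so [h (m - 1) <= h m <= m]. *)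
have htm : m < k -> h m.-1 = m.
  move=> mk'; have := hE m m; have := bdiag _ mk'; have := hstep m.-1.
  by rewrite prednK //; lia.
exists (h m.-1), [set s : 'I_k | (0 < s < m) && (h s.-1 < h s)].
set S := [set s | _].
have Sm : S \subset rises m by apply/subsetP => s; rewrite !inE => /andP[].
split=> //; first lia.
move=> i j ji iN jk; rewrite /stair.
(* From column [m] on both sides are true: the ones start at the diagonal, and [t = m]. *)
case: (ltnP j m) => jm; last first.
  rewrite hE //.
  have := hE j j (leqnn j) (leq_ltn_trans ji iN) jk; rewrite bdiag // jm.
  by lia.
rewrite hE // -(@count_above_heights h m j) ?leq_add2r //.
by move=> j' j'm; apply: hstep; lia.
Qed.

Lemma card_rises m : m <= k -> #|rises m| = m.-1.
Proof.
case: m => [_|m mk].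
  by apply: eq_card0 => s; rewrite inE ltn0 andbF.
rewrite /rises -sum1dep_card.
rewrite -(big_mkord (fun s => 0 < s < m.+1) (fun=> 1)).
rewrite (big_cat_nat (leq0n _) mk) //= [X in _ + X]big1_seq ?addn0; last first.
  by move=> s; rewrite mem_index_iota; lia.
rewrite big_ltn_cond //= big_nat_cond.
rewrite (eq_bigl (fun s => 1 <= s < m.+1)); last by move=> s; lia.
by rewrite -big_nat sum_nat_const_nat muln1 subn1.
Qed.

End Staircase.

Arguments staircase k N b : clear implicits.

(** * From integer arrays to 0/1 arrays *)

Lemma threshold (N : nat) (d : nat -> bool) :
  (forall i, (i.+1 < N)%N -> d i -> d i.+1) ->
  exists2 m, (m <= N)%N & forall i, (i < N)%N -> d i = (m <= i)%N.
Proof.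
elim: N => [|N IH] dS; first by exists 0%N.
have [m mN dE] := IH (fun i iN => dS i (ltnW iN)).
have [dN|dN] := boolP (d N).
  exists m => [|i]; first exact: leqW.
  by rewrite ltnS leq_eqVlt => /orP[/eqP->|/dE//]; rewrite dN mN.
have m_max : m = N.
  apply/eqP; rewrite eqn_leq mN leqNgt; apply/negP => mN'.
  case: N => // N in dS IH mN dE dN mN' *.
  by move: dN; rewrite dS // dE.
exists N.+1 => // i; rewrite ltnS leq_eqVlt => /orP[/eqP->|iN].
  by rewrite ltnn (negbTE dN).
by rewrite dE // m_max; lia.
Qed.

(** Counting from 0 turns [max(i, j) - 1] into [maxn i j]. *)
Definition deficit_array (n k : nat) (b : nat -> nat -> bool) :
    'M[int]_(n, k) :=
  \matrix_(i, j) ((maxn i j)%:Z - (b i j)%:Z).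

(** The last corner holds [n - 2], one less than its maximum [n - 1], so its deficit is 1. A deficit
    of 0 or 1 meets [rule3] with [r = 1]. *)
Lemma deficit_arrayP (n k : nat) (b : nat -> nat -> bool) :
  (0 < k <= n)%N ->
  arrays 1 n k (deficit_array n k b) <->
  [/\ b 0%N 0%N = false, b n.-1 k.-1, staircase k n b
    & staircase k k (fun i j => b j i)].
Proof.
move=> /andP[k_gt0 kn]; set A := deficit_array n k b.
have AE (i j : nat) (lt_in : (i < n)%N) (lt_jk : (j < k)%N) :
    A (Ordinal lt_in) (Ordinal lt_jk) = (maxn i j)%:Z - (b i j)%:Z.
  by rewrite mxE.
split.
  move=> [[A00 Anr] A2 _].
  have step i j i' j' : precedes i' j' i j -> (i < n)%N -> (j < k)%N ->
      (maxn i j)%:Z - (b i j)%:Z = (maxn i' j')%:Z - (b i' j')%:Z \/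
      (maxn i j)%:Z - (b i j)%:Z = (maxn i' j')%:Z - (b i' j')%:Z + 1.
    move=> pre lt_in lt_jk.
    have lt_i'n : (i' < n)%N by case: pre; lia.
    have lt_j'k : (j' < k)%N by case: pre; lia.
    rewrite -(AE _ _ lt_in lt_jk) -(AE _ _ lt_i'n lt_j'k).
    exact: A2.
  have vert i j : (i.+1 < n)%N -> (j < k)%N -> _ :=
    step i.+1 j i j (Or31 _ _ (conj erefl erefl)).
  have hor i j : (i < n)%N -> (j.+1 < k)%N -> _ :=
    step i j.+1 i j (Or32 _ _ (conj erefl erefl)).
  have slant i j : (i.+1 < n)%N -> (j.+1 < k)%N -> _ :=
    step i.+1 j.+1 i j (Or33 _ _ (conj erefl erefl)).
  split.
  - have n_gt0 : (0 < n)%N by lia.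
    by have := A00 (Ordinal n_gt0) (Ordinal k_gt0) erefl erefl; rewrite AE; lia.
  - have n1 : (n.-1 < n)%N by lia.
    have k1 : (k.-1 < k)%N by lia.
    have := Anr (Ordinal n1) (Ordinal k1); rewrite AE /= !prednK; lia.
  - split=> i j; [have := vert i j | have := hor i j | have := slant i j]; lia.
  - split=> i j; [have := hor j i | have := vert j i | have := slant j i]; lia.
move=> [b00 bnk [down left slant] [down' left' slant']]; split.
- split=> i j; rewrite mxE => iE jE.
    have -> : i = 0%N :> nat by lia.
    have -> : j = 0%N :> nat by lia.
    by rewrite b00.
  have -> : i = n.-1 :> nat by lia.
  have -> : j = k.-1 :> nat by lia.
  by rewrite bnk; lia.
- move=> i i' j j'; rewrite !mxE; have := ltn_ord i; have := ltn_ord j.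
  move: (i : nat) (i' : nat) (j : nat) (j' : nat) => {}i {}i' {}j {}j'.
  move=> jk lt_in; case=> -[iE jE]; move: jk lt_in; rewrite -iE -jE.
  + have := down i' j'; have := left' j' i'; lia.
  + have := down' j' i'; have := left i' j'; lia.
  + have := slant i' j'; have := slant' j' i'; lia.
- by move=> i j; rewrite mxE; case: (b i j); lia.
Qed.

Lemma arrays_deficit (n k : nat) (A : 'M[int]_(n, k)) :
  (0 < k <= n)%N -> arrays 1 n k A -> exists b, A = deficit_array n k b.
Proof.
case: n A => [|n]; first by case: k.
case: k => [|k] A // kn [[A00 _] A2 A3].
(* [rule3] bounds the deficit by 1 in absolute value; its sign comes from walking back to the first
   corner, each step lowering the maximum by exactly 1. *)
have Amax d (i : 'I_n.+1) (j : 'I_k.+1) : maxn i j = d -> A i j <= d%:Z.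
  elim: d i j => [|d IH] i j ijE; first by rewrite A00 //; lia.
  have lt_in : (i.-1 < n.+1)%N by have := ltn_ord i; lia.
  have lt_jk : (j.-1 < k.+1)%N by have := ltn_ord j; lia.
  have := IH (Ordinal lt_in) (Ordinal lt_jk).
  have := A2 i (Ordinal lt_in) j (Ordinal lt_jk).
  rewrite /precedes /=.
  case: (posnP i) => i0; case: (posnP j) => j0; first lia.
  - by case; [constructor 2; lia | |]; lia.
  - by case; [constructor 1; lia | |]; lia.
  - by case; [constructor 3; lia | |]; lia.
exists (fun i j => A (inord i) (inord j) < (maxn i j)%:Z).
apply/matrixP => i j; rewrite mxE !inord_val.
have := Amax _ i j erefl; have := A3 i j; case: ltP; lia.
Qed.

Lemma eq_staircase (k N : nat) (b b' : nat -> nat -> bool) :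
  (forall i j, (j <= i)%N -> (i < N)%N -> (j < k)%N -> b i j = b' i j) ->
  staircase k N b -> staircase k N b'.
Proof.
move=> eqb [down left slant]; split=> i j.
- by have := down i j; have := eqb i j; have := eqb i.+1 j; lia.
- by have := left i j; have := eqb i j; have := eqb i j.+1; lia.
- by have := slant i j; have := eqb i j; have := eqb i.+1 j.+1; lia.
Qed.

Lemma deficit_array_inj (n k : nat) (b b' : nat -> nat -> bool) :
  deficit_array n k b = deficit_array n k b' <->
  (forall i j, (i < n)%N -> (j < k)%N -> b i j = b' i j).
Proof.
split=> [/matrixP eqA i j lt_in lt_jk|eqb].
  by have := eqA (Ordinal lt_in) (Ordinal lt_jk); rewrite !mxE /=; lia.
by apply/matrixP => i j; rewrite !mxE eqb.
Qed.

(** * Coding the arrays by a start and two sets of rises *)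

Section Codes.
Variables (n k : nat).
Hypothesis nk : (0 < k <= n)%N.

Definition code : Type := 'I_n * ({set 'I_k} * {set 'I_k}).

(** A code is the start [t] with the rises of the lower and the upper half. Deficit 0 in the first
    corner means [0 < t]; deficit 1 in the last means [t < n], which the ordinal type provides. *)
Definition codes : {set code} :=
  [set x : code | (0 < x.1)%N &
     let R := powerset (rises (minn x.1 k)) in x.2 \in setX R R].

(** Transposed, the upper half has only [k] rows, so its start is [m = min(t, k)]. *)
Definition code_deficit (x : code) (i j : nat) : bool :=
  if (j <= i)%N then stair x.1 x.2.1 i j else stair (minn x.1 k) x.2.2 j i.

Lemma mem_codes (x : code) : x \in codes ->
  [/\ (0 < x.1 < n)%N, x.2.1 \subset rises (minn x.1 k)
    & x.2.2 \subset rises (minn x.1 k)].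
Proof. by rewrite !inE /= !inE => /and3P[-> -> ->]; rewrite ltn_ord. Qed.

Lemma code_deficit_lower (x : code) (i j : nat) :
  (j <= i)%N -> code_deficit x i j = stair x.1 x.2.1 i j.
Proof. by rewrite /code_deficit => ->. Qed.

Lemma code_deficit_diag (x : code) (j : nat) :
  x \in codes -> (j < k)%N -> code_deficit x j j = (minn x.1 k <= j)%N.
Proof.
move=> /mem_codes[_ Sl _] jk.
by rewrite code_deficit_lower // (stair_diag Sl).
Qed.

(** The diagonal is included: by [stair_diag] both stairs agree there. *)
Lemma code_deficit_upper (x : code) (i j : nat) :
  x \in codes -> (j <= i)%N -> (i < k)%N ->
  code_deficit x j i = stair (minn x.1 k) x.2.2 i j.
Proof.
move=> xC; rewrite leq_eqVlt => /orP[/eqP -> ik|ji _].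
  have [_ _ Su] := mem_codes xC.
  by rewrite code_deficit_diag // (stair_diag Su) //; lia.
by rewrite /code_deficit leqNgt ji.
Qed.

Lemma arrays_codes (A : 'M[int]_(n, k)) :
  arrays 1 n k A <->
  exists2 x, x \in codes & A = deficit_array n k (code_deficit x).
Proof.
split=> [AA|[x xC ->]]; last first.
  have [tn Sl Su] := mem_codes xC; apply/(deficit_arrayP _ nk); split.
  - by rewrite code_deficit_diag //; lia.
  - by rewrite code_deficit_lower /stair; lia.
  - apply: eq_staircase (stair_staircase n x.1 x.2.1) => i j ji _ _.
    by rewrite code_deficit_lower.
  - apply: eq_staircase (stair_staircase k (minn x.1 k) x.2.2) => i j ji ik _.
    by rewrite code_deficit_upper.
have [b Ab] := arrays_deficit nk AA; move: AA; rewrite {A}Ab.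
move=> /(deficit_arrayP _ nk)[b00 bnk lower upper].
have [k_gt0 kn] := andP nk.
(* Slanted closure makes the diagonal monotone; [m = k] stands for a diagonal without ones. *)
have [m mk bdiag] : exists2 m, (m <= k)%N &
    forall j, (j < k)%N -> b j j = (m <= j)%N.
  by apply: threshold => j jk; case: lower => _ _; apply; lia.
have m_gt0 : (0 < m)%N by have := bdiag 0%N k_gt0; rewrite b00; lia.
have m_rng : (0 < m <= k)%N by rewrite m_gt0.
have [t [Sl [Slm tm _ bl]]] := stair_surj m_rng kn lower bdiag.
have [t' [Su [Sum t'm t'k bu]]] := stair_surj m_rng (leqnn k) upper bdiag.
(* No rise follows the last column, so its 1 in row [n - 1] says [t <= n - 1]. *)
have tn : (t < n)%N.
  have := bl n.-1 k.-1; rewrite bnk /stair count_above_ge; lia.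
exists (Ordinal tn, (Sl, Su)); first by rewrite !inE /= !inE tm Slm Sum; lia.
apply/deficit_array_inj => i j lt_in lt_jk; rewrite /code_deficit /=.
case: leqP => ij; first exact: bl.
(* [t' <= k] and [minn t' k = m] leave only [t' = m]. *)
have -> : minn t k = t' by lia.
by apply: bu => //; lia.
Qed.

(** The diagonal determines [m]; then each half determines its start and its rises. *)
Lemma code_array_inj :
  {in codes &, injective (fun x => deficit_array n k (code_deficit x))}.
Proof.
move=> [tx [Slx Sux]] [ty [Sly Suy]] xC yC /deficit_array_inj eqxy.
have /= [txn Slxm Suxm] := mem_codes xC.
have /= [tyn Slym Suym] := mem_codes yC.
have [k_gt0 kn] := andP nk.
have mE : minn ty k = minn tx k.
  have dg j : (j < k)%N -> (minn tx k <= j)%N = (minn ty k <= j)%N.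
    move=> jk; have := eqxy j j; rewrite !code_deficit_diag //= => -> //.
    exact: leq_trans kn.
  by have := dg (minn tx k); have := dg (minn ty k); lia.
rewrite mE in Slym Suym.
have m_gt0 : (0 < minn tx k)%N by lia.
have [t_eq Sl_eq] : tx = ty :> nat /\ Slx = Sly.
  apply: (stair_inj m_gt0 kn _ _ Slxm Slym); try lia.
  move=> i j ji lt_in lt_jk.
  by have := eqxy i j lt_in lt_jk; rewrite !code_deficit_lower.
have [_ Su_eq] : minn tx k = minn ty k /\ Sux = Suy.
  apply: (stair_inj m_gt0 (leqnn k) _ _ Suxm Suym); try lia.
  move=> i j ji ik jk.
  by have := eqxy j i; rewrite !code_deficit_upper //=; apply; lia.
by rewrite (val_inj t_eq) Sl_eq Su_eq.
Qed.

(** * Number of codes and the closed form *)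

Lemma card_codes : #|codes| = (\sum_(1 <= t < n) 4 ^ (minn t k).-1)%N.
Proof.
rewrite -sum1dep_card -(pair_big_dep (fun t : 'I_n => 0 < t)%N
  (fun t y => let R := powerset (rises (minn t k)) in y \in setX R R)
  (fun _ _ => 1%N)) /=.
transitivity (\sum_(t < n | (0 < t)%N) 4 ^ (minn t k).-1)%N.
  apply: eq_bigr => t _.
  (* With [m = min(t, k)], two independent subsets of [m - 1] columns give
     [2^(m - 1) * 2^(m - 1)]. *)
  by rewrite sum1_card cardsX card_powerset card_rises ?geq_minr // -expnMn.
have n_gt0 : (0 < n)%N by lia.
rewrite -(big_mkord (fun t => 0 < t)%N (fun t => 4 ^ (minn t k).-1)%N).
rewrite big_ltn_cond //= big_nat_cond [RHS]big_nat_cond.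
by apply: eq_bigl => t; lia.
Qed.

Lemma H_codes : H 1 n k = #|codes|.
Proof.
rewrite /H.
have -> : fset_set (arrays 1 n k) =
    [fset deficit_array n k (code_deficit x) | x in codes]%fset.
  apply/fsetP => A; rewrite in_fset_set; last exact: finite_arrays.
  apply/idP/imfsetP => [/set_mem/arrays_codes[x xC ->]|[x xC ->]].
    by exists x.
  by apply/mem_set/arrays_codes; exists x.
rewrite card_in_imfset /=; last exact: code_array_inj.
by rewrite cardE.
Qed.

End Codes.

Theorem theorem2 (n k : nat) (hk : (1 <= k)%N) (hkn : (k <= n)%N) :
  (H 1 n k)%:R =
    4 ^+ (k - 1)%N * (n%:R - k%:R) + 1 / 3 * (4 ^+ (k - 1)%N - 1) :> rat.
Proof.
have nk : (0 < k <= n)%N by rewrite hk.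
rewrite H_codes // card_codes // natr_sum {nk}.
have [d ->] : exists d, n = (k + d)%N by exists (n - k)%N; rewrite subnKC.
(* For [t >= k] the summand is constantly [4^(k - 1)]; for [t < k] it is [4^(t - 1)], a geometric
   sum. *)
rewrite (big_cat_nat hk) ?leq_addr //= {hkn}.
have -> : \sum_(k <= t < k + d) (4 ^ (minn t k).-1)%:R =
    4 ^+ (k - 1)%N * d%:R :> rat.
  rewrite big_nat (eq_bigr (fun=> 4 ^+ (k - 1)%N)) => [|t /andP[kt _]].
    by rewrite -big_nat sumr_const_nat addKn mulr_natr.
  by rewrite (minn_idPr kt) natrX subn1.
have -> : \sum_(1 <= t < k) (4 ^ (minn t k).-1)%:R =
    1 / 3 * (4 ^+ (k - 1)%N - 1) :> rat.
  rewrite big_nat (eq_bigr (fun t => 4 ^+ t.-1)) => [|t /andP[_ /ltnW tk]].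
    rewrite -big_nat; case: k hk => // l _; rewrite subn1 big_add1 /=.
    elim: l => [|l IH]; first by rewrite big_geq // subrr mulr0.
    by rewrite big_nat_recr //= IH exprS; field.
  by rewrite (minn_idPl tk) natrX.
by rewrite natrD; ring.
Qed.
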